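(* Let $G=(V,E)$ be a connected graph and let $t\geq 1$ be an integer. Then $G$ is isomorphic to the uniform theta graph $\Theta(t,2)$ if and only if \[ \operatorname{Spec}(T(G)) = \left\{ 1^{(1)},\ \tfrac{1}{2}^{(t)},\ -\tfrac{1}{2}^{(t)},\ -1^{(1)} \right\}. \]
   Context: Graphs are simple and finite. For a graph $G=(V,E)$ with adjacency matrix $A$ and diagonal degree matrix $D$, the normalized adjacency matrix is $T(G)=D^{-1/2}AD^{-1/2}$. $\operatorname{Spec}(M)$ denotes the multiset of eigenvalues of $M$ counted with algebraic multiplicity; a parenthesized superscript indicates the multiplicity (so $\frac12^{(t)}$ means the eigenvalue $\frac12$ with multiplicity $t$). The uniform theta graph $\Theta(t,2)$ is obtained from $t$ pairwise vertex-disjoint path graphs on $2$ vertices by adding two new vertices and, for each path, joining one endpoint to the first new vertex and the other endpoint to the second new vertex. *)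

(* Defs.v *)
From HB Require Import structures.
From mathcomp Require Import all_boot all_order all_algebra.
From mathcomp Require Import finmap multiset.

Set Implicit Arguments.
Unset Strict Implicit.
Unset Printing Implicit Defensive.

Import Order.TTheory GRing.Theory Num.Theory.
Local Open Scope ring_scope.

Record sgraph := SGraph {
  vertex :> finType;
  adj : rel vertex;
  adj_sym : symmetric adj;
  adj_irr : irreflexive adj
}.

Arguments adj {s} x y.

Definition degree (G : sgraph) (x : G) : nat := #|[set y | adj x y]|.

Definition connected (G : sgraph) : Prop :=
  (0 < #|G|)%N /\ forall x y : G, connect (@adj G) x y.

Definition isomorphic (G H : sgraph) : Prop :=
  exists2 f : G -> H, bijective f & forall x y : G, adj (f x) (f y) = adj x y.

(* The vertex [inr (i, c)] is the [c]-th vertex of the [i]-th of [t] disjoint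
   paths on [k] vertices; [inl false] and [inl true] are the two new vertices,
   joined to the initial (resp. final) vertex of every path. *)
Definition theta_adj (t k : nat) : rel (bool + 'I_t * 'I_k)%type :=
  fun x y =>
    match x, y with
    | inr (i, c), inr (j, d) =>
        (i == j) && ((c.+1 == d :> nat) || (d.+1 == c :> nat))
    | inl b, inr (_, c) | inr (_, c), inl b =>
        if b then c.+1 == k :> nat else c == 0 :> nat
    | inl _, inl _ => false
    end.

Lemma theta_adj_sym (t k : nat) : symmetric (@theta_adj t k).
Proof.
by case=> [b|[i c]] [b'|[j d]] //=; rewrite eq_sym orbC.
Qed.

Lemma theta_adj_irr (t k : nat) : irreflexive (@theta_adj t k).
Proof.
by case=> [b|[i c]] //=; rewrite eqxx orbb eqn_leq ltnn.
Qed.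

Definition theta (t k : nat) : sgraph :=
  SGraph (@theta_adj_sym t k) (@theta_adj_irr t k).

(* Matrices of [G] are indexed by ['I_#|G|] through the enumeration of the
   vertices; the spectrum does not depend on this ordering. *)
Definition adjacency_mx (C : numClosedFieldType) (G : sgraph) : 'M[C]_#|G| :=
  \matrix_(i, j) (adj (enum_val i) (enum_val j))%:R.

(* [D ^ (-1/2)], with the convention [0 ^ (-1/2) = 0] at isolated vertices. *)
Definition degree_mx_invsqrt (C : numClosedFieldType) (G : sgraph) :
    'M[C]_#|G| :=
  diag_mx (\row_i (sqrtC (degree (enum_val i))%:R)^-1).

Definition normalized_adjacency_mx (C : numClosedFieldType) (G : sgraph) :
    'M[C]_#|G| :=
  degree_mx_invsqrt C G *m adjacency_mx C G *m degree_mx_invsqrt C G.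

(* [closed_field_poly_normal p] yields a list [s] such that
   [p = lead_coef p *: \prod_(z <- s) ('X - z%:P)]. *)
Definition Spec (C : numClosedFieldType) (n : nat) (M : 'M[C]_n) : {mset C}%mset :=
  seq_mset (sval (closed_field_poly_normal (char_poly M))).

Lemma SpecE (C : numClosedFieldType) (n : nat) (M : 'M[C]_n) (a : C) :
  Spec M a = mup a (char_poly M).
Proof.
rewrite /Spec; case: closed_field_poly_normal => s /= ->.
by rewrite (monicP (char_poly_monic M)) scale1r mset_seqE mu_prod_XsubC.
Qed.

(* Main.v *)
(* Write [d] for the degree.  Entrywise, [T ^ 2] is the weighted count
   [two_step x y = sum_(z ~ x, y) 1 / d z], scaled by [(d x * d y) ^ (-1/2)].
   If the spectrum is [{1, 1/2^t, -1/2^t, -1}], then [G] is bipartite and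
   [(T ^ 2 - 1) (T ^ 2 - 1/4) = 0], so the columns of [T ^ 2 - 1/4] are fixed by
   [T ^ 2]; by connectedness they are proportional to [sqrt d] on each side.
   Hence [two_step x y = [x = y] d x / 4 + c * d x * d y] for [x], [y] on the
   same side, where [c = 3 / (4 * #|E|)], and both sides have [t + 1] vertices.
   Summing the diagonal identity bounds the edges by [4 (t + 1) - 3 delta], which
   forces the minimum degree [delta <= 3]; comparing a vertex of minimum degree
   with the others on its side rules out 3, leaves only the path on 4 vertices
   for 1, and for 2 exhibits the two hubs of the theta graph.
   Conversely the identity holds in [theta t 2], so only the four eigenvalues
   can occur, and their multiplicities follow from the size of [T] and the
   traces of [T], [T ^ 2] and [T ^ 3]. *)
Require Import Defs.
From mathcomp Require Import all_boot all_order all_algebra.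
From mathcomp Require Import finmap multiset.
From mathcomp Require Import ring lra zify.

Set Implicit Arguments.
Unset Strict Implicit.
Unset Printing Implicit Defensive.

Import Order.TTheory GRing.Theory Num.Theory.
Local Open Scope ring_scope.

(** * Spectra of real symmetric matrices *)

Lemma char_poly_similar (R : comUnitRingType) (n : nat) (P A : 'M[R]_n) :
  P \in unitmx -> char_poly (invmx P *m A *m P) = char_poly A.
Proof.
move=> uP; pose Q := map_mx (@polyC R) P; pose Q' := map_mx (@polyC R) (invmx P).
have Q'Q : Q' *m Q = 1%:M by rewrite -map_mxM mulVmx // map_mx1.
rewrite /char_poly.
have -> : char_poly_mx (invmx P *m A *m P) = Q' *m char_poly_mx A *m Q.
  rewrite /char_poly_mx mulmxBr mulmxBl !map_mxM; congr (_ - _).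
  by rewrite scalar_mxC -mulmxA Q'Q mulmx1.
by rewrite !det_mulmx mulrAC -det_mulmx Q'Q det1 mul1r.
Qed.

(** A real symmetric matrix is Hermitian, so the spectral theorem applies. The same row [d] serves
    for the matrix and for its characteristic polynomial, so traces and spectral multiplicities can
    both be read off from [d]. *)
Lemma hermitian_diagonalization (C : numClosedFieldType) (n : nat) (A : 'M[C]_n) :
  A \is symmetricmx -> A \is a mxOver Num.real ->
  exists2 P : 'M[C]_n, P \in unitmx &
  exists2 d : 'rV[C]_n, A = invmx P *m diag_mx d *m P &
    char_poly A = \prod_(i < n) ('X - (d 0 i)%:P).
Proof.
move=> As Ar.
have /orthomx_spectralP E := hermitian_normalmx (realsym_hermsym As Ar).
exists (spectralmx A); first exact: spectral_unit.
exists (spectral_diag A) => //; rewrite {1}E.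
rewrite char_poly_similar ?spectral_unit // char_poly_trig ?diag_mx_is_trig //.
by apply: eq_bigr => i _; rewrite mxE eqxx.
Qed.

Lemma mxtrace_similar (R : comUnitRingType) (n : nat) (P A : 'M[R]_n) :
  P \in unitmx -> \tr (invmx P *m A *m P) = \tr A.
Proof. by move=> uP; rewrite mxtrace_mulC mulmxA mulmxV // mul1mx. Qed.

Lemma similar_mulmx (R : comUnitRingType) (n : nat) (P A B : 'M[R]_n) :
  P \in unitmx ->
  (invmx P *m A *m P) *m (invmx P *m B *m P) = invmx P *m (A *m B) *m P.
Proof. by move=> uP; rewrite !mulmxA mulmxK. Qed.

Lemma Spec_diagonalizationE (C : numClosedFieldType) (n : nat) (A : 'M[C]_n) (d : 'rV[C]_n) (a : C) :
  char_poly A = \prod_(i < n) ('X - (d 0 i)%:P) ->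
  Spec A a = #|[set i | d 0 i == a]|.
Proof.
move=> E; rewrite SpecE E -(big_map (fun i => d 0 i) predT (fun z => 'X - z%:P)).
by rewrite mu_prod_XsubC count_map -sum1_count sum1dep_card.
Qed.

(* [(z ^+ 2 - 1) * (z ^+ 2 - 1 / 4)]. *)
Definition quartic (F : fieldType) (z : F) := z ^+ 4 - 5 / 4 * z ^+ 2 + 1 / 4.

Lemma quartic_roots (C : numFieldType) (z : C) :
  quartic z = 0 <-> z \in [:: 1; 1 / 2; - (1 / 2); - 1].
Proof.
have -> : quartic z = (z - 1) * (z - 1 / 2) * (z + 1 / 2) * (z + 1).
  by rewrite /quartic; field.
rewrite !inE; split.
  by move/eqP; rewrite !mulf_eq0 !subr_eq0 !addr_eq0 -!orbA.
by do !case/predU1P => [->|]; last move/eqP->; rewrite ?subrr ?addNr ?mulr0 ?mul0r ?mulr0.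
Qed.

(** Conjugation by [P] turns a polynomial in [A] into the diagonal matrix of its values at the
    eigenvalues. *)
Lemma spectrum_quartic (C : numClosedFieldType) (n : nat) (A P : 'M[C]_n) (d : 'rV[C]_n) :
  P \in unitmx -> A = invmx P *m diag_mx d *m P ->
  (A *m A) *m (A *m A) - (5 / 4) *: (A *m A) + (1 / 4)%:M = 0 <->
  forall i, quartic (d 0 i) = 0.
Proof.
move=> uP ->; rewrite !similar_mulmx // !mulmx_diag.
have -> : (1 / 4)%:M = invmx P *m (1 / 4)%:M *m P :> 'M[C]_n.
  by rewrite scalar_mxC -mulmxA mulVmx // mulmx1.
rewrite scalemxAl scalemxAr -mulmxBl -mulmxBr -mulmxDl -mulmxDr.
set B := (X in invmx P *m X *m P).
have EB : B = diag_mx (\row_i quartic (d 0 i)).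
  apply/matrixP => i j; rewrite !mxE /quartic; case: (i == j); rewrite ?mulr1n ?mulr0n.
    by ring.
  by rewrite mulr0 subr0 addr0.
split=> [E i|E].
  have B0 : B = 0.
    by rewrite -[B](mulKVmx uP) -[_ *m B](mulmxK uP) E mul0mx mulmx0.
  have := congr1 (fun M : 'M[C]_n => M i i) EB.
  by rewrite B0 !mxE eqxx mulr1n => <-.
suff -> : B = 0 by rewrite mulmx0 mul0mx.
by rewrite EB; apply/matrixP => i j; rewrite !mxE E mul0rn.
Qed.

(** * Two-step walks *)

(** The entry of [A D^-1 A]. It is rational: the square roots of degrees in [T ^ 2] survive only as
    outer factors, so the combinatorial part needs no reference to [C]. *)
Definition two_step (G : sgraph) (x y : G) : rat :=
  \sum_(z | adj x z && adj z y) (degree z)%:R^-1.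

Definition volume (G : sgraph) : rat := \sum_(x : G) (degree x)%:R.

(* Equivalent to [T ^ 2 - 1/4 = 3/4 * (projection on the span of the vectors
   [sqrt d] restricted to each side)]; each side carries half of the volume. *)
Definition walk_identity (G : sgraph) (side : G -> bool) :=
  (forall x y : G, adj x y -> side y = ~~ side x) /\
  forall x y : G, side x = side y ->
    two_step x y = (x == y)%:R * ((degree x)%:R / 4)
                   + 3 / (2 * volume G) * (degree x)%:R * (degree y)%:R.

Lemma degree_sum (F : fieldType) (G : sgraph) (x : G) :
  (degree x)%:R = \sum_(y | adj x y) 1 :> F.
Proof. by rewrite /degree -sum1dep_card natr_sum. Qed.

Lemma two_step_sym (G : sgraph) (x y : G) : two_step x y = two_step y x.
Proof. by apply: eq_bigl => z; rewrite andbC adj_sym [adj x z]adj_sym. Qed.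

(** A neighbour [z] of [x] has [degree z] continuations of weight [1 / degree z], so it contributes
    1. *)
Lemma two_step_row (G : sgraph) (x : G) :
  (forall z : G, 0 < degree z)%N -> \sum_y two_step x y = (degree x)%:R.
Proof.
move=> dpos; rewrite /two_step.
under eq_bigr do rewrite big_mkcond.
rewrite exchange_big /= degree_sum [RHS]big_mkcond /=.
apply: eq_bigr => z _; rewrite -big_mkcond /=; case: adj => /=; last first.
  by rewrite big_pred0.
rewrite -[(degree z)%:R^-1]mul1r -mulr_suml -degree_sum divff //.
by rewrite pnatr_eq0 -lt0n.
Qed.

(** Every edge has exactly one end on each side, so both degree sums count the edges. *)
Lemma side_volume (G : sgraph) (side : G -> bool) (b : bool) :
  (forall x y : G, adj x y -> side y = ~~ side x) ->
  \sum_(x | side x == b) (degree x)%:R = volume G / 2.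
Proof.
move=> bip; pose S b := \sum_(x : G | side x == b) (degree x)%:R : rat.
have SE c : S c = \sum_(x | side x == c) \sum_(y | side y == ~~ c) (adj x y)%:R.
  apply: eq_bigr => x /eqP sx; rewrite degree_sum big_mkcond [RHS]big_mkcond /=.
  apply: eq_bigr => y _; case: (boolP (adj x y)) => [/bip ->|_].
    by rewrite sx eqxx.
  by case: ifP.
have Seq : S true = S false.
  rewrite !SE /= exchange_big /=; apply: eq_bigr => x _; apply: eq_bigr => y _.
  by rewrite adj_sym.
have -> : volume G = S true + S false.
  rewrite /volume (bigID (fun x => side x)) /=.
  by congr (_ + _); apply: eq_bigl => x; rewrite ?eqb_id // eqbF_neg.
rewrite -/(S b); case: b; rewrite ?Seq; lra.
Qed.

(* Equality case of the nonnegativity of the Dirichlet form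
   [sum_(x, y) w x y * `|h x - e * h y| ^+ 2]. *)
Lemma harmonic_eq (C : numClosedFieldType) (I : finType) (w : I -> I -> C)
    (e : C) (h : I -> C) :
  (forall x y, 0 <= w x y) -> (forall x y, w x y = w y x) ->
  e \is Num.real -> e ^+ 2 = 1 ->
  (forall x, \sum_y w x y * h y = e * (\sum_y w x y) * h x) ->
  forall x y, w x y != 0 -> h x = e * h y.
Proof.
move=> w0 ws er e2 hh.
have eC : e^* = e by apply/CrealP.
pose D x y := w x y * ((h x - e * h y) * (h x - e * h y)^*).
have D0 x y : 0 <= D x y by rewrite mulr_ge0 // mul_conjC_ge0.
(* Expanding [D] gives two norm terms and two cross terms. Each of the four double sums equals [N]:
   the norm terms by symmetry of [w], the cross terms by the hypothesis on [h] and [e ^+ 2 = 1].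
   Hence [D] sums to 0. *)
pose N := \sum_x (\sum_y w x y) * (h x * (h x)^*).
have N1 : \sum_x \sum_y w x y * (h x * (h x)^*) = N.
  by apply: eq_bigr => x _; rewrite mulr_suml.
have N2 : \sum_x \sum_y w x y * (h y * (h y)^*) = N.
  rewrite -N1 exchange_big /=; apply: eq_bigr => x _; apply: eq_bigr => y _.
  by rewrite ws.
have X1 : \sum_x \sum_y e * (w x y * h y * (h x)^*) = N.
  apply: eq_bigr => x _; rewrite -mulr_sumr -mulr_suml hh.
  by rewrite !mulrA -expr2 e2 mul1r -!mulrA.
have X2 : \sum_x \sum_y e * (w x y * (h y)^* * h x) = N.
  rewrite -X1 exchange_big /=; apply: eq_bigr => x _; apply: eq_bigr => y _.
  by rewrite ws mulrAC.
have sumD : \sum_x \sum_y D x y = 0.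
  have -> : \sum_x \sum_y D x y =
     \sum_x \sum_y w x y * (h x * (h x)^*)
     + \sum_x \sum_y w x y * (h y * (h y)^*)
     - \sum_x \sum_y e * (w x y * h y * (h x)^*)
     - \sum_x \sum_y e * (w x y * (h y)^* * h x).
    rewrite -big_split -!sumrB /=; apply: eq_bigr => x _.
    rewrite -big_split -!sumrB /=; apply: eq_bigr => y _.
    rewrite /D rmorphB rmorphM /= eC.
    transitivity (w x y * (h x * (h x)^*) + e ^+ 2 * (w x y * (h y * (h y)^*))
       - e * (w x y * h y * (h x)^*) - e * (w x y * (h y)^* * h x)).
      by ring.
    by rewrite e2 mul1r.
  by rewrite N1 N2 X1 X2 addrK subrr.
move=> x y wxy.
have Dx : \sum_y D x y = 0.
  by apply: (psumr_eq0P _ sumD) => // i _; apply: sumr_ge0.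
have /eqP : D x y = 0 by apply: (psumr_eq0P _ Dx) => // z _; apply: D0.
rewrite mulf_eq0 (negPf wxy) mul_conjC_eq0 subr_eq0 => /eqP; exact.
Qed.

Lemma const_on_sides (T : Type) (G : sgraph) (side : G -> bool) (F : G -> T) :
  connected G -> (forall x y : G, adj x y -> side y = ~~ side x) ->
  (forall x y z : G, adj x z -> adj z y -> F x = F y) ->
  forall x y : G, side x = side y -> F x = F y.
Proof.
move=> [_ conn] bip FE x y sxy.
(* Invariant along a path from [x]: on the side of [x] the value is [F x], and on the opposite side
   every neighbour has the value [F x]. *)
suff H : forall p u, path adj u p ->
    (if side u == side x then F u = F x else forall z, adj u z -> F z = F x) ->
    (if side (last u p) == side x then F (last u p) = F x
     else forall z, adj (last u p) z -> F z = F x).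
  have /connectP[p pP E] := conn x y.
  have := H p x pP; rewrite eqxx -E sxy eqxx => /(_ erefl) //.
elim=> [|v p IH] u //= /andP[uv pP] Hu; apply: IH => //.
move: Hu; rewrite (bip _ _ uv); case: (side u); case: (side x) => //=.
- by move=> E z vz; rewrite -E; apply/esym; exact: FE uv vz.
- by move=> E; exact: E.
- by move=> E; exact: E.
- by move=> E z vz; rewrite -E; apply/esym; exact: FE uv vz.
Qed.

(** * Entries of the normalized adjacency matrix and of its square *)

Definition isqrt_degree (C : numClosedFieldType) (G : sgraph) (x : G) : C :=
  (sqrtC (degree x)%:R)^-1.

Lemma isqrt_degree_sqr (C : numClosedFieldType) (G : sgraph) (x : G) :
  isqrt_degree C x * isqrt_degree C x = (degree x)%:R^-1.
Proof. by rewrite /isqrt_degree -invfM -expr2 sqrtCK. Qed.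

Lemma isqrt_degree_neq0 (C : numClosedFieldType) (G : sgraph) (x : G) :
  (0 < degree x)%N -> isqrt_degree C x != 0.
Proof. by move=> dx; rewrite invr_eq0 sqrtC_eq0 pnatr_eq0 -lt0n. Qed.

Lemma normalized_adjacencyE (C : numClosedFieldType) (G : sgraph) (i j : 'I_#|G|) :
  normalized_adjacency_mx C G i j =
  isqrt_degree C (enum_val i) * (adj (enum_val i) (enum_val j))%:R
    * isqrt_degree C (enum_val j).
Proof.
rewrite /normalized_adjacency_mx /degree_mx_invsqrt.
by rewrite mul_mx_diag mul_diag_mx !mxE.
Qed.

Lemma normalized_adjacency_sym (C : numClosedFieldType) (G : sgraph) :
  normalized_adjacency_mx C G \is symmetricmx.
Proof.
apply/is_hermitianmxP; rewrite expr0 scale1r.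
apply/matrixP => i j; rewrite [RHS]mxE [in RHS]mxE /= !normalized_adjacencyE adj_sym.
by rewrite mulrC mulrA mulrAC.
Qed.

Lemma normalized_adjacency_real (C : numClosedFieldType) (G : sgraph) :
  normalized_adjacency_mx C G \is a mxOver Num.real.
Proof.
apply/mxOverP => i j; rewrite normalized_adjacencyE ger0_real //.
by rewrite !mulr_ge0 ?invr_ge0 ?sqrtC_ge0 ?ler0n.
Qed.

Lemma sum_enum_val (V : nmodType) (G : finType) (F : G -> V) :
  \sum_(i < #|G|) F (enum_val i) = \sum_x F x.
Proof. by rewrite (reindex (fun i : 'I_#|G| => enum_val i)) //; exact/onW_bij/enum_val_bij. Qed.

Lemma normalized_adjacency_sqrE (C : numClosedFieldType) (G : sgraph) (i j : 'I_#|G|) :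
  let T := normalized_adjacency_mx C G in
  (T *m T) i j = isqrt_degree C (enum_val i)
    * ratr (two_step (enum_val i) (enum_val j)) * isqrt_degree C (enum_val j).
Proof.
rewrite /= mxE; under eq_bigr do rewrite !normalized_adjacencyE.
rewrite (sum_enum_val (fun z => isqrt_degree C (enum_val i) * (adj (enum_val i) z)%:R
  * isqrt_degree C z * (isqrt_degree C z * (adj z (enum_val j))%:R
  * isqrt_degree C (enum_val j)))).
rewrite /two_step rmorph_sum /= mulr_sumr mulr_suml [RHS]big_mkcond /=.
apply: eq_bigr => z _; rewrite fmorphV /= ratr_nat -isqrt_degree_sqr.
case: (adj _ z); case: (adj z _); rewrite /=; ring.
Qed.

(** The entry of [D^(1/2) (T ^ 2 - 1/4) D^(1/2)]. *)
Definition two_step_excess (G : sgraph) (x y : G) : rat :=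
  two_step x y - (x == y)%:R * ((degree x)%:R / 4).

(** With [K = T ^ 2 - 1/4], the quartic factors as [(T ^ 2 - 1) K], so it vanishes exactly when
    [T ^ 2 K = K]. Cancelling the nonzero outer factors [isqrt_degree] leaves an identity between
    rational numbers. *)
Lemma quartic_two_step (C : numClosedFieldType) (G : sgraph) :
  let T := normalized_adjacency_mx C G in
  (forall z : G, 0 < degree z)%N ->
  T *m T *m (T *m T) - (5 / 4) *: (T *m T) + (1 / 4)%:M = 0 <->
  forall x y : G, \sum_z two_step x z * (two_step_excess z y / (degree z)%:R)
                  = two_step_excess x y.
Proof.
move=> T dpos; set T2 := T *m T.
have KE i j : (T2 - (1 / 4)%:M) i j = isqrt_degree C (enum_val i)
    * ratr (two_step_excess (enum_val i) (enum_val j)) * isqrt_degree C (enum_val j).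
  rewrite [LHS]mxE /T2 normalized_adjacency_sqrE !mxE /two_step_excess.
  rewrite rmorphB /= mulrBr mulrBl; congr (_ - _).
  rewrite (inj_eq enum_val_inj); case: eqP => [->|_]; last first.
    by rewrite mul0r rmorph0 mulr0 mul0r.
  rewrite mulr1n !mul1r mulrAC isqrt_degree_sqr fmorph_div /= !ratr_nat.
  by rewrite mulrA mulVf ?mul1r // pnatr_eq0 -lt0n.
have TKE i j : (T2 *m (T2 - (1 / 4)%:M)) i j = isqrt_degree C (enum_val i)
    * ratr (\sum_z two_step (enum_val i) z
                   * (two_step_excess z (enum_val j) / (degree z)%:R))
    * isqrt_degree C (enum_val j).
  rewrite mxE; under eq_bigr do rewrite KE /T2 normalized_adjacency_sqrE.
  rewrite (sum_enum_val (fun z => isqrt_degree C (enum_val i)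
    * ratr (two_step (enum_val i) z) * isqrt_degree C z * (isqrt_degree C z
    * ratr (two_step_excess z (enum_val j)) * isqrt_degree C (enum_val j)))).
  rewrite rmorph_sum /= mulr_sumr mulr_suml; apply: eq_bigr => z _.
  by rewrite !rmorphM /= fmorphV /= ratr_nat -isqrt_degree_sqr; ring.
have -> : T2 *m T2 - (5 / 4) *: T2 + (1 / 4)%:M
        = T2 *m (T2 - (1 / 4)%:M) - (T2 - (1 / 4)%:M).
  rewrite mulmxBr mul_mx_scalar; apply/matrixP => i j; rewrite !mxE.
  by field.
split=> [/subr0_eq E x y|E]; last first.
  suff -> : T2 *m (T2 - (1 / 4)%:M) = T2 - (1 / 4)%:M by rewrite subrr.
  by apply/matrixP => i j; rewrite TKE KE E.
apply: (fmorph_inj (ratr : rat -> C)).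
have := TKE (enum_rank x) (enum_rank y); rewrite E KE !enum_rankK.
by move/(mulIf (isqrt_degree_neq0 C (dpos y)))/(mulfI (isqrt_degree_neq0 C (dpos x))).
Qed.

Lemma two_step_opposite (G : sgraph) (side : G -> bool) (x y : G) :
  (forall x y : G, adj x y -> side y = ~~ side x) ->
  side x != side y -> two_step x y = 0.
Proof.
move=> bip sxy; rewrite /two_step big_pred0 // => z.
apply/negP => /andP[/bip xz /bip zy]; move: sxy; rewrite zy xz negbK.
by rewrite eqxx.
Qed.

Lemma volume_gt0 (G : sgraph) (x : G) : (0 < degree x)%N -> 0 < volume G.
Proof.
move=> dx; rewrite /volume (bigD1 x) //=; apply: ltr_wpDr; last by rewrite ltr0n.
by apply: sumr_ge0 => *; rewrite ler0n.
Qed.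

(** The excess of [z] and [y] divided by [degree z] is constant in [z] on the side of [y] and 0 on
    the other side, so the sum reduces to [two_step_row]. *)
Lemma walk_identity_two_step (G : sgraph) (side : G -> bool) :
  (forall z : G, 0 < degree z)%N -> walk_identity side ->
  forall x y : G, \sum_z two_step x z * (two_step_excess z y / (degree z)%:R)
                  = two_step_excess x y.
Proof.
move=> dpos [bip W] x y; pose c : rat := 3 / (2 * volume G).
have EE u v : two_step_excess u v
    = (side u == side v)%:R * (c * (degree u)%:R * (degree v)%:R).
  rewrite /two_step_excess; case: (eqVneq (side u) (side v)) => [suv|suv].
    by rewrite W // mul1r -/c; ring.
  rewrite (two_step_opposite bip) //; case: (u =P v) suv => [->|_]; rewrite ?eqxx //.
  by rewrite !mul0r subr0.
transitivity (\sum_z two_step x z * ((side z == side y)%:R * (c * (degree y)%:R))).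
  apply: eq_bigr => z _; congr (_ * _); rewrite EE.
  have : (degree z)%:R != 0 :> rat by rewrite pnatr_eq0 -lt0n.
  by move=> ?; field.
transitivity ((side x == side y)%:R * \sum_z two_step x z * (c * (degree y)%:R)).
  rewrite mulr_sumr; apply: eq_bigr => z _.
  case: (eqVneq (side x) (side z)) => [->|xz].
    by ring.
  by rewrite (two_step_opposite bip xz); ring.
by rewrite -mulr_suml two_step_row // EE; ring.
Qed.

(** The hypothesis says that each column of the excess, divided by the degree, is harmonic for the
    weights [two_step]. Such a function is constant on each side. *)
Lemma walk_identity_of_two_step (C : numClosedFieldType) (G : sgraph) (side : G -> bool) :
  connected G -> (forall z : G, 0 < degree z)%N ->
  (forall x y : G, adj x y -> side y = ~~ side x) ->
  (forall x y : G, \sum_z two_step x z * (two_step_excess z y / (degree z)%:R)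
                  = two_step_excess x y) ->
  walk_identity side.
Proof.
move=> conn dpos bip E; split=> // x y sxy.
have dneq0 (z : G) : (degree z)%:R != 0 :> rat by rewrite pnatr_eq0 -lt0n.
have Esym u v : two_step_excess u v = two_step_excess v u.
  by rewrite /two_step_excess two_step_sym eq_sym; case: eqP => [->|_] //; rewrite !mul0r.
have ts_ge0 u v : 0 <= two_step u v by apply: sumr_ge0 => *; rewrite invr_ge0 ler0n.
have const u v v' : side v = side v' ->
    two_step_excess v u / (degree v)%:R = two_step_excess v' u / (degree v')%:R.
  apply: (const_on_sides (side := side)
    (F := fun v => two_step_excess v u / (degree v)%:R)) => // a b z az zb.
  apply: (fmorph_inj (ratr : rat -> C)).
  have := @harmonic_eq C G (fun a b => ratr (two_step a b)) 1
    (fun v => ratr (two_step_excess v u / (degree v)%:R)).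
  move=> /(_ _ _ _ _ _ a b); rewrite mul1r; apply.
  - by move=> *; rewrite ler0q.
  - by move=> *; rewrite two_step_sym.
  - exact: rpred1.
  - by rewrite expr1n.
  - move=> {az zb}a; rewrite mul1r -rmorph_sum -rmorphM two_step_row // /=.
    under eq_bigr do rewrite -rmorphM.
    by rewrite -rmorph_sum E /= mulrC divfK.
  - rewrite fmorph_eq0 gt_eqF // /two_step (bigD1 z) /= ?az ?zb //.
    by apply: ltr_wpDr; [apply: sumr_ge0 => *|]; rewrite ?invr_ge0 ?invr_gt0 ?ler0n ?ltr0n.
(* By symmetry of the excess, constancy of its columns after division by the degree makes it
   proportional to the product of the two degrees on one side. *)
pose k := two_step_excess x x / ((degree x)%:R * (degree x)%:R).
have EE v : side v = side x ->
    two_step_excess x v = k * (degree x)%:R * (degree v)%:R.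
  move=> sv; rewrite -Esym -[LHS](divfK (dneq0 v)) (const _ _ _ sv) /k.
  by field.
(* The row sum of the excess at [x] is computed twice: from [two_step_row], and from the product
   form with half of the volume on the side of [x]. *)
have kE : k = 3 / (2 * volume G).
  have S0 : \sum_z two_step_excess x z = 3 / 4 * (degree x)%:R.
    rewrite /two_step_excess sumrB two_step_row // (bigD1 x) //= eqxx.
    rewrite big1 ?addr0; last by move=> z /negPf; rewrite eq_sym => ->; rewrite mul0r.
    by rewrite mul1r; field.
  have S1 : \sum_z two_step_excess x z = k * (degree x)%:R * (volume G / 2).
    rewrite -(side_volume (side x) bip) mulr_sumr [RHS]big_mkcond /=.
    apply: eq_bigr => z _; case: eqVneq => [sz|sz]; first exact: EE.
    rewrite /two_step_excess (two_step_opposite bip); last by rewrite eq_sym.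
    by case: (x =P z) sz => [->|_]; rewrite ?eqxx // mul0r subr0.
  have v0 : volume G != 0 by rewrite gt_eqF // (volume_gt0 (dpos x)).
  have : k * (degree x)%:R * (volume G / 2) = 3 / 4 * (degree x)%:R by rewrite -S1.
  rewrite mulrAC => /(mulIf (dneq0 x)) kE.
  have -> : k = k * (volume G / 2) * 2 / volume G by field.
  by rewrite kE; field.
by rewrite -kE -EE // /two_step_excess subrKC.
Qed.

(** * The walk identity and the spectrum *)

(** Rescaling an eigenvector for [-1] by [D^(-1/2)] gives a function [h] to which [harmonic_eq]
    applies with [e = -1]: [h] changes sign along every edge, and its sign defines the sides. *)
Lemma bipartite_of_eigenvalue (C : numClosedFieldType) (G : sgraph) :
  connected G -> (forall z : G, 0 < degree z)%N ->
  eigenvalue (normalized_adjacency_mx C G) (- 1) ->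
  exists side : G -> bool, forall x y : G, adj x y -> side y = ~~ side x.
Proof.
move=> [_ conn] dpos /eigenvalueP[v vT /rV0Pn[i0 vi0]].
have sneq0 := fun x : G => isqrt_degree_neq0 C (dpos x).
pose h (x : G) := v 0 (enum_rank x) * isqrt_degree C x.
have hE x : \sum_y (adj x y)%:R * h y = - (degree x)%:R * h x.
  have := congr1 (fun u : 'rV[C]_#|G| => u 0 (enum_rank x)) vT.
  rewrite mxE [in RHS]mxE => E; apply: (mulIf (sneq0 x)).
  transitivity (- 1 * v 0 (enum_rank x)); last first.
    rewrite /h !mulNr mul1r -!mulrA isqrt_degree_sqr mulrCA.
    by rewrite divff ?mulr1 // pnatr_eq0 -lt0n.
  rewrite -E mulr_suml -sum_enum_val; apply: eq_bigr => k _.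
  by rewrite normalized_adjacencyE /h enum_valK enum_rankK adj_sym; ring.
have anti x y : adj x y -> h x = - h y.
  move=> xy; rewrite -[RHS]mulN1r.
  apply: (@harmonic_eq C G (fun a b => (adj a b)%:R) (- 1) h).
  - by move=> *; rewrite ler0n.
  - by move=> a b; rewrite adj_sym.
  - by rewrite rpredN rpred1.
  - by rewrite sqrrN expr1n.
  - move=> z; rewrite hE mulN1r; congr (- _ * _).
    by rewrite degree_sum big_mkcond; apply: eq_bigr => ? _; case: adj.
  - by rewrite xy oner_eq0.
(* By connectedness [h] takes only the values [c] and [- c], which are distinct since [c] is
   nonzero. *)
pose c := h (enum_val i0).
have c0 : c != 0 by rewrite mulf_neq0 // enum_valK.
have hpm x : h x = c \/ h x = - c.
  have /connectP[p pP ->] := conn (enum_val i0) x.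
  suff H : forall p u, path adj u p -> h u = c \/ h u = - c ->
      h (last u p) = c \/ h (last u p) = - c by apply: H => //; left.
  elim=> [|w q IH] u //= /andP[uw qP] Hu; apply: IH => //.
  by move: Hu; rewrite (anti _ _ uw) => -[<-|/oppr_inj ->]; rewrite ?opprK; [right|left].
have cN : c != - c.
  by rewrite -subr_eq0 opprK -mulr2n mulrn_eq0 negb_or c0.
exists (fun x => h x == c) => x y /anti E.
have := hpm y; rewrite E eqr_oppLR => -[->|->]; first by rewrite eqxx (negPf cN).
by rewrite eqxx eq_sym (negPf cN).
Qed.

Lemma normalized_adjacency_trace (C : numClosedFieldType) (G : sgraph) :
  \tr (normalized_adjacency_mx C G) = 0.
Proof.
by apply: big1 => i _; rewrite normalized_adjacencyE adj_irr mulr0 mul0r.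
Qed.

Lemma normalized_adjacency_trace2 (C : numClosedFieldType) (G : sgraph) :
  let T := normalized_adjacency_mx C G in
  \tr (T *m T) = ratr (\sum_(x : G) two_step x x / (degree x)%:R).
Proof.
rewrite /mxtrace rmorph_sum /= -(sum_enum_val (fun x : G => ratr (two_step x x / (degree x)%:R))); apply: eq_bigr => i _.
by rewrite normalized_adjacency_sqrE mulrAC isqrt_degree_sqr fmorph_div /= ratr_nat mulrC.
Qed.

(** A bipartite graph has no closed walk of length 3. *)
Lemma normalized_adjacency_trace3 (C : numClosedFieldType) (G : sgraph) (side : G -> bool) :
  (forall x y : G, adj x y -> side y = ~~ side x) ->
  let T := normalized_adjacency_mx C G in \tr (T *m T *m T) = 0.
Proof.
move=> bip T; apply: big1 => i _; rewrite mxE; apply: big1 => k _.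
rewrite normalized_adjacency_sqrE normalized_adjacencyE.
case: (boolP (adj _ _)) => [/bip ski|_]; last by rewrite !(mulr0, mul0r).
by rewrite (two_step_opposite bip) ?rmorph0 ?(mulr0, mul0r) // ski; case: (side _).
Qed.

Lemma sum_by_value (F : fieldType) (n : nat) (d : 'I_n -> F) (s : seq F) (f : F -> F) :
  uniq s -> (forall i, d i \in s) ->
  \sum_i f (d i) = \sum_(a <- s) (#|[set i | d i == a]|)%:R * f a.
Proof.
move=> us ds.
transitivity (\sum_i \sum_(a <- s) (d i == a)%:R * f a).
  apply: eq_bigr => i _; rewrite (bigD1_seq (d i)) //= eqxx mul1r big1 ?addr0 //.
  by move=> a; rewrite eq_sym => /negPf ->; rewrite mul0r.
rewrite exchange_big /=; apply: eq_bigr => a _; rewrite -mulr_suml; congr (_ * _).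
rewrite -sum1dep_card natr_sum [RHS]big_mkcond; apply: eq_bigr => i _.
by case: eqP.
Qed.

Lemma quartic_roots_uniq (C : numFieldType) : uniq [:: 1; 1 / 2; - (1 / 2); - 1 : C].
Proof.
have n0 (n : nat) : n.+1%:R != 0 :> C by rewrite pnatr_eq0.
(* Roots are separated by showing that twice their difference is a positive integer, which is
   nonzero in characteristic 0. *)
have key (a b : C) (k : nat) : 2 * (a - b) = k.+1%:R -> a != b.
  by apply: contra_eqN => /eqP ->; rewrite subrr mulr0 eq_sym.
rewrite /= !inE !negb_or andbT.
have -> : (1 : C) != 1 / 2 by apply: (key _ _ 0%N); field.
have -> : (1 : C) != - (1 / 2) by apply: (key _ _ 2%N); field.
have -> : (1 : C) != - 1 by apply: (key _ _ 3%N); ring.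
have -> : (1 / 2 : C) != - (1 / 2) by apply: (key _ _ 1%N); field.
have -> : (1 / 2 : C) != - 1 by apply: (key _ _ 2%N); field.
by have -> : (- (1 / 2) : C) != - 1 by apply: (key _ _ 0%N); field.
Qed.

(** The size of [T] and the traces of [T], [T ^ 2], [T ^ 3] give four linear equations for the
    multiplicities of the four possible eigenvalues. The system is of Vandermonde type, hence has a
    single solution. *)
Lemma spectrum_of_walk (C : numClosedFieldType) (G : sgraph) (side : G -> bool) (t : nat) :
  (forall z : G, 0 < degree z)%N -> #|G| = (2 * t + 2)%N -> walk_identity side ->
  Spec (normalized_adjacency_mx C G) =
    (msetn 1%N (1 : C) `+` msetn t (1 / 2 : C)
       `+` msetn t (- (1 / 2) : C) `+` msetn 1%N (- 1 : C))%mset.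
Proof.
move=> dpos cardG W; have [bip Wxy] := W; set T := normalized_adjacency_mx C G.
have [P uP [d TE charT]] := hermitian_diagonalization
  (normalized_adjacency_sym C G) (normalized_adjacency_real C G).
have /(spectrum_quartic uP TE) droots :=
  (quartic_two_step C dpos).2 (walk_identity_two_step dpos W).
pose s : seq C := [:: 1; 1 / 2; - (1 / 2); - 1].
have ds i : d 0 i \in s by exact/quartic_roots.
have us : uniq s := quartic_roots_uniq C.
pose m a := #|[set i | d 0 i == a]|.
have S0 : \sum_(i < #|G|) 1 = (2 * t + 2)%:R :> C.
  by rewrite sumr_const card_ord cardG.
have S1 : \sum_i d 0 i = 0.
  rewrite -[RHS](normalized_adjacency_trace C G) TE.
  by rewrite mxtrace_similar // mxtrace_diag.
have S2 : \sum_i d 0 i ^+ 2 = (t%:R + 4) / 2.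
  transitivity (\tr (T *m T)).
    rewrite /T TE similar_mulmx // mxtrace_similar // mulmx_diag mxtrace_diag.
    by apply: eq_bigr => i _; rewrite mxE expr2.
  rewrite normalized_adjacency_trace2.
  have -> : \sum_(x : G) two_step x x / (degree x)%:R = (t%:R + 4) / 2.
    (* The diagonal of the walk identity divided by the degree. The sum is
       [(2 t + 2) / 4 + 3 / 2]. *)
    transitivity (\sum_(x : G) (1 / 4 + 3 / (2 * volume G) * (degree x)%:R)).
      apply: eq_bigr => x _; rewrite Wxy // eqxx !mul1r; move: (3 / _) => c.
      have : (degree x)%:R != 0 :> rat by rewrite pnatr_eq0 -lt0n.
      by move=> ?; field.
    rewrite big_split /= sumr_const -mulr_sumr -/(volume G).
    have [x _] : exists x : G, true.
      by move: cardG; case: (pickP G) => [x _|/eq_card0 ->]; [exists x|lia].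
    have v0 : volume G != 0 by rewrite gt_eqF // (volume_gt0 (dpos x)).
    rewrite cardG -[_ *+ (2 * t + 2)]mulr_natr natrD natrM; field; exact: v0.
  by rewrite fmorph_div /= rmorphD /= !ratr_nat.
have S3 : \sum_i d 0 i ^+ 3 = 0.
  rewrite -[RHS](normalized_adjacency_trace3 C bip) TE !similar_mulmx //.
  rewrite mxtrace_similar // !mulmx_diag mxtrace_diag.
  by apply: eq_bigr => i _; rewrite !mxE; ring.
move: S0 S1 S2 S3.
rewrite (sum_by_value (fun=> 1) us ds) (sum_by_value id us ds).
rewrite (sum_by_value (fun z => z ^+ 2) us ds) (sum_by_value (fun z => z ^+ 3) us ds).
rewrite !big_cons !big_nil -!/(m _) /= => S0 S1 S2 S3.
have inj (a b : nat) : a%:R = b%:R :> C -> a = b.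
  by move/eqP; rewrite eqr_nat => /eqP.
(* The equations are multiplied by 1, 2, 4 and 8 and their negative terms moved across, so that they
   hold between natural numbers. *)
have N0 : (m 1%R + m (1 / 2)%R + m (- (1 / 2))%R + m (- 1)%R = 2 * t + 2)%N.
  by apply: inj; rewrite -S0 !natrD; ring.
have N1 : (2 * m 1%R + m (1 / 2)%R = 2 * m (- 1)%R + m (- (1 / 2))%R)%N.
  apply: inj; apply/eqP; rewrite -subr_eq0; apply/eqP.
  by rewrite -[RHS](mulr0 2) -S1 natrD natrM natrD natrM; field.
have N2 : (4 * (m 1%R + m (- 1)%R) + m (1 / 2)%R + m (- (1 / 2))%R = 2 * t + 8)%N.
  apply: inj; transitivity (4 * ((t%:R + 4) / 2) : C); last first.
    by rewrite natrD natrM; field.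
  by rewrite -S2 natrD natrD natrM natrD; field.
have N3 : (8 * m 1%R + m (1 / 2)%R = 8 * m (- 1)%R + m (- (1 / 2))%R)%N.
  apply: inj; apply/eqP; rewrite -subr_eq0; apply/eqP.
  by rewrite -[RHS](mulr0 8) -S3 natrD natrM natrD natrM; field.
apply/msetP => a; rewrite (Spec_diagonalizationE a charT) -/(m a) !msetE2 !msetnE.
have [as_|aNs] := boolP (a \in s); last first.
  have -> : m a = 0%N.
    apply/eqP; rewrite cards_eq0; apply/eqP/setP => i; rewrite !inE.
    by apply/negP => /eqP E; rewrite -E ds in aNs.
  by move: aNs; rewrite !inE !negb_or => /and4P[/negPf-> /negPf-> /negPf-> /negPf->].
have := us; rewrite /= !inE !negb_or andbT.
move=> /and3P[/and3P[e12 e13 e14] /andP[e23 e24] e34].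
have E (z w : C) : z != w -> ((z == w) = false) * ((w == z) = false).
  by move=> zw; rewrite [w == z]eq_sym (negPf zw).
have [M1 M2 M3 M4] : [/\ m 1%R = 1, m (1 / 2)%R = t, m (- (1 / 2))%R = t & m (- 1)%R = 1]%N.
  by clear -N0 N1 N2 N3; split; lia.
move: as_; rewrite !inE => /or4P[]/eqP->;
  rewrite ?eqxx ?(E _ _ e12) ?(E _ _ e13) ?(E _ _ e14) ?(E _ _ e23) ?(E _ _ e24) ?(E _ _ e34);
  by rewrite ?addn0 ?add0n.
Qed.

(** The eigenvalue [-1] yields the bipartition; that every eigenvalue is a root of the quartic
    yields the matrix relation. *)
Lemma walk_of_spectrum (C : numClosedFieldType) (G : sgraph) (t : nat) :
  connected G -> (forall z : G, 0 < degree z)%N ->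
  Spec (normalized_adjacency_mx C G) =
    (msetn 1%N (1 : C) `+` msetn t (1 / 2 : C)
       `+` msetn t (- (1 / 2) : C) `+` msetn 1%N (- 1 : C))%mset ->
  exists side : G -> bool, walk_identity side.
Proof.
move=> conn dpos SpecT.
have [P uP [d TE charT]] := hermitian_diagonalization
  (normalized_adjacency_sym C G) (normalized_adjacency_real C G).
have [|side bip] := @bipartite_of_eigenvalue C G conn dpos; last first.
  exists side; apply: (walk_identity_of_two_step C conn dpos bip).
  apply/(quartic_two_step C dpos)/(spectrum_quartic uP TE) => i.
  apply/quartic_roots.
  have : (0 < Spec (normalized_adjacency_mx C G) (d 0 i)%R)%N.
    by rewrite (Spec_diagonalizationE _ charT); apply/card_gt0P; exists i; rewrite inE.
  rewrite SpecT !msetE2 !msetnE !inE.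
  by do 4!case: eqP => //=.
have : (0 < Spec (normalized_adjacency_mx C G) (- 1)%R)%N.
  by rewrite SpecT !msetE2 !msetnE eqxx addn1.
rewrite (Spec_diagonalizationE _ charT) => /card_gt0P[i]; rewrite inE => /eqP di.
by rewrite eigenvalue_root_char charT (bigD1 i) //= rootM root_XsubC di eqxx.
Qed.

Lemma card_of_spectrum (C : numClosedFieldType) (G : sgraph) (t : nat) :
  Spec (normalized_adjacency_mx C G) =
    (msetn 1%N (1 : C) `+` msetn t (1 / 2 : C)
       `+` msetn t (- (1 / 2) : C) `+` msetn 1%N (- 1 : C))%mset ->
  #|G| = (2 * t + 2)%N.
Proof.
move=> SpecT; set A := normalized_adjacency_mx C G.
have : size (Spec A) = #|G|.
  have := size_char_poly A; rewrite /Spec.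
  case: closed_field_poly_normal => s /= ->.
  rewrite (monicP (char_poly_monic _)) scale1r size_prod_XsubC => -[<-].
  exact/perm_size/perm_eq_seq_mset.
rewrite SpecT => <-.
have szD (X Y : {mset C}%mset) : size (X `+` Y)%mset = (size X + size Y)%N.
  rewrite -size_cat; apply/perm_size/allP => a _ /=.
  by rewrite count_cat !count_mem_mset msetE2.
by rewrite !szD !enum_msetn !size_nseq; lia.
Qed.

(** * Theta graphs *)

Lemma degree_gt0 (G : sgraph) : connected G -> (1 < #|G|)%N ->
  forall z : G, (0 < degree z)%N.
Proof.
move=> [_ conn] cardG z; rewrite lt0n cards_eq0; apply/negP => /eqP Nz.
have [x xz] : exists x : G, x != z.
  apply/existsP; rewrite -negb_forall; apply: contraTN cardG => /forallP zG.
  by rewrite -leqNgt -(card1 z); apply/subset_leq_card/subsetP => y _; rewrite inE.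
have /connectP[[|y p] /= pP E] := conn z x; first by rewrite E eqxx in xz.
by move/setP/(_ y): Nz; rewrite !inE; case/andP: pP => ->.
Qed.

Lemma isomorphic_of_injective (G H : sgraph) (g : H -> G) :
  injective g -> #|G| = #|H| -> (forall x y, adj (g x) (g y) = adj x y) ->
  isomorphic G H.
Proof.
move=> ginj cardE gadj.
have [f gK fK] : bijective g by apply: inj_card_bij; rewrite ?cardE.
by exists f; [exists g | move=> x y; rewrite -gadj !fK].
Qed.

Lemma card_theta (t k : nat) : #|theta t k| = (2 + t * k)%N.
Proof. by rewrite card_sum card_bool card_prod !card_ord. Qed.

Lemma sum_theta (V : nmodType) (t : nat) (F : theta t 2 -> V) :
  \sum_z F z = F (inl false) + F (inl true)
    + \sum_(i < t) (F (inr (i, ord0)) + F (inr (i, ord_max))).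
Proof.
rewrite big_sumType big_bool /= [X in X + _ = _]addrC; congr (_ + _).
rewrite (eq_bigr (fun p => F (inr (p.1, p.2)))); last by case.
rewrite -(pair_bigA _ (fun i c => F (inr (i, c)))); apply: eq_bigr => i _.
by rewrite big_ord_recl big_ord1; congr (_ + F (inr (_, _))); apply: val_inj.
Qed.

Lemma ord2P (P : 'I_2 -> Prop) : P ord0 -> P ord_max -> forall c, P c.
Proof.
by move=> P0 P1 [[|[|//]] c2]; [move: P0|move: P1]; congr P; apply: val_inj.
Qed.

Lemma degree_theta (t : nat) (x : theta t 2) :
  degree x = if x is inl _ then t else 2.
Proof.
have -> : degree x = \sum_y (adj x y)%:R :> nat.
  rewrite /degree -sum1dep_card big_mkcond; apply: eq_bigr => y _.
  by case: adj.
rewrite sum_theta; case: x => [b|[i c]] /=.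
  rewrite [RHS](_ : t = \sum_(i < t) 1)%N; last by rewrite sum1_card card_ord.
  by case: b; apply: eq_bigr.
rewrite (bigD1 i) //= eqxx big1 => [|j /negPf ij].
  by elim/ord2P: c.
by rewrite eq_sym ij.
Qed.

(** The hub [inl b] lies on side [b], together with the path vertices adjacent to the other hub. *)
Definition theta_side (t : nat) (x : theta t 2) : bool :=
  match x with inl b => b | inr (_, c) => c == ord0 end.

Lemma volume_theta (t : nat) : volume (theta t 2) = (6 * t)%:R.
Proof.
rewrite /volume sum_theta !degree_theta; under eq_bigr do rewrite !degree_theta -natrD.
rewrite sumr_const card_ord -mulrnA -!natrD.
by congr _%:R; lia.
Qed.

(** The volume is [6 t], so the coefficient of the degree product is [1 / (4 t)]. The values of
    [two_step] on one side are [t / 2] for a hub and itself, [1 / 2] for a hub and a path vertex,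
    [1 / t] for two distinct path vertices, and [1 / 2 + 1 / t] for a path vertex and itself. *)
Lemma theta_walk_identity (t : nat) : (0 < t)%N -> walk_identity (@theta_side t).
Proof.
move=> t0; have tn0 : t%:R != 0 :> rat by rewrite pnatr_eq0 -lt0n.
split.
  by move=> [[]|[i c]] [[]|[j d]] //=; try elim/ord2P: c => //; try elim/ord2P: d;
     rewrite ?andbF.
(* The only intermediate vertex is the other vertex of path [j], of degree 2. *)
have hub_path b j d : b = theta_side (inr (j, d) : theta t 2) ->
    two_step (inl b : theta t 2) (inr (j, d)) = 2^-1.
  rewrite /two_step big_mkcond sum_theta (bigD1 j) //= eqxx !degree_theta.
  rewrite big1 => [|i /negPf ->]; last by rewrite /= !andbF addr0.
  by elim/ord2P: d => ->; rewrite /= !(addr0, add0r).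
move=> x y sxy; rewrite volume_theta !degree_theta natrM.
case: x y sxy => [b|[i c]] [b'|[j d]] /=.
- move=> <-; rewrite eqxx mul1r /two_step big_mkcond sum_theta /= !add0r.
  under eq_bigr do rewrite !degree_theta.
  by case: b; rewrite /= sumr_const card_ord -mulr_natr ?addr0 ?add0r; field.
- by move=> sb; rewrite hub_path // mul0r add0r; field.
- by move=> sb; rewrite two_step_sym hub_path // mul0r add0r; field.
move=> sij; have -> : (inr (i, c) == inr (j, d) :> theta t 2) = (i == j).
  rewrite [LHS](_ : _ = (i == j) && (c == d)) //.
  by move: sij; elim/ord2P: c; elim/ord2P: d => //=; rewrite andbT.
rewrite /two_step big_mkcond sum_theta (bigD1 i) //= eqxx !degree_theta.
rewrite big1 => [|k /negPf]; last by rewrite eq_sym => -> /=; rewrite addr0.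
move: sij; elim/ord2P: c; elim/ord2P: d => //= _;
  case: (i == j) => /=; rewrite !(addr0, add0r); field; done.
Qed.

Lemma walk_identity_iso (G H : sgraph) (side : H -> bool) :
  isomorphic G H -> walk_identity side ->
  exists side' : G -> bool, walk_identity side'.
Proof.
move=> [f fbij fadj] [bip W]; exists (side \o f).
have degf x : degree (f x) = degree x.
  rewrite /degree -!sum1dep_card (reindex f) /=; last exact: onW_bij.
  by apply: eq_bigl => y; rewrite fadj.
have tsf x y : two_step (f x) (f y) = two_step x y.
  rewrite /two_step (reindex f) /=; last exact: onW_bij.
  by apply: eq_big => [z|z _]; rewrite ?fadj ?degf.
have volf : volume H = volume G.
  rewrite /volume (reindex f) /=; last exact: onW_bij.
  by apply: eq_bigr => x _; rewrite degf.
split=> [x y xy|x y sxy] /=; first by apply: bip; rewrite fadj.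
by rewrite -tsf W // volf !degf (inj_eq (bij_inj fbij)).
Qed.

Lemma card_gt1_neq (T : finType) (A : {set T}) (x : T) :
  (1 < #|A|)%N -> exists2 y, y \in A & y != x.
Proof.
move=> A1; have /card_gt0P[y] : (0 < #|A :\ x|)%N.
  by have := cardsD1 x A; case: (x \in A); lia.
by rewrite !inE => /andP[yx yA]; exists y.
Qed.

(** Recognition of the theta graph: [w] and [u] become the hubs. Each other vertex [a i] on the side
    of [w] is adjacent to [u] and to exactly one further vertex [b i]. The [b i] are distinct
    because two of the [a i] share only [u], and the vertex count shows that nothing else
    remains. *)
Lemma theta_of_hubs (G : sgraph) (side : G -> bool) (t : nat) (w u : G) :
  #|G| = (2 + t * 2)%N -> #|[set x | side x == side w]| = t.+1 ->
  (forall x y, adj x y -> side y = ~~ side x) ->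
  side u = ~~ side w -> ~~ adj w u ->
  (forall y, side y = side w -> y != w -> adj u y) ->
  (forall z, side z = side u -> z != u -> adj w z) ->
  (forall y, side y = side w -> y != w ->
     exists z, [/\ z != u, adj y z & forall z', adj y z' -> z' \in [:: u; z]]) ->
  (forall y y' z, side y = side w -> side y' = side w -> y != w -> y' != w ->
     y != y' -> adj y z -> adj y' z -> z = u) ->
  isomorphic G (theta t 2).
Proof.
move=> cardG cardA bip su wu Hu Hw Hf Hinj.
pose S := [set y | (side y == side w) && (y != w)].
have cardS : #|S| = t.
  have := cardsD1 w [set x | side x == side w]; rewrite cardA inE eqxx => -[->].
  by apply: eq_card => y; rewrite !inE andbC.
(* Replacing [t] by the cardinal of [S] lets [enum_val] index the paths without a cast. *)
move: cardG; rewrite -{t cardA}cardS => cardG.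
pose a (i : 'I_#|S|) : G := enum_val i.
have aS i : side (a i) = side w /\ a i != w.
  by have := enum_valP i; rewrite inE => /andP[/eqP].
have ainj : injective a := enum_val_inj.
have [b bP] : exists b : 'I_#|S| -> G, forall i,
    [/\ b i != u, adj (a i) (b i) & forall z', adj (a i) z' -> z' \in [:: u; b i]].
  have bPi i : exists z, [/\ z != u, adj (a i) z & forall z', adj (a i) z' -> z' \in [:: u; z]].
    by have [sa aw] := aS i; exact: Hf.
  exact: (fin_all_exists bPi).
have sb i : side (b i) = side u.
  by have [_ /bip -> _] := bP i; rewrite (aS i).1 su.
have binj : injective b.
  move=> i j bij; apply: ainj; apply/eqP; apply: contraT => aij.
  have [bu ab _] := bP i; have [_ ab' _] := bP j.
  have [si wi] := aS i; have [sj wj] := aS j.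
  by rewrite -bij in ab'; rewrite (Hinj _ _ _ si sj wi wj aij ab ab') eqxx in bu.
pose g (x : theta #|S| 2) : G := match x with
  | inl false => u | inl true => w
  | inr (i, c) => if c == ord0 then a i else b i end.
have same_side x y : side x = side y -> adj x y = false.
  by move=> sxy; apply/negP => /bip; rewrite sxy; case: (side y).
have suw : side u != side w by rewrite su; case: (side w).
have ub i : adj u (b i) = false by apply: same_side; rewrite sb.
have wa i : adj w (a i) = false by apply: same_side; rewrite (aS i).1.
have ua i : adj u (a i) by have [sa aw] := aS i; exact: Hu.
have wb i : adj w (b i) by have [bu _ _] := bP i; apply: Hw.
have abE i j : adj (a i) (b j) = (i == j).
  apply/idP/eqP => [ab|->]; last by have [] := bP j.
  have [_ _ /(_ _ ab)] := bP i; have [bu _ _] := bP j.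
  by rewrite !inE (negPf bu) /= => /eqP /binj.
have gadj x y : adj (g x) (g y) = adj x y.
  case: x y => [[]|[i c]] [[]|[j d]] /=.
  - by rewrite adj_irr.
  - exact: negPf.
  - by elim/ord2P: d; rewrite /= ?wa ?wb.
  - by rewrite adj_sym; exact: negPf.
  - by rewrite adj_irr.
  - by elim/ord2P: d; rewrite /= ?ua ?ub.
  - by rewrite adj_sym; elim/ord2P: c; rewrite /= ?wa ?wb.
  - by rewrite adj_sym; elim/ord2P: c; rewrite /= ?ua ?ub.
  elim/ord2P: c; elim/ord2P: d => /=; rewrite ?andbT ?andbF ?abE //.
  - by apply: same_side; rewrite !(aS _).1.
  - by rewrite adj_sym abE eq_sym.
  - by apply: same_side; rewrite !sb.
apply: (isomorphic_of_injective (g := g)) => //; last by rewrite card_theta.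
have sab i j : a i <> b j.
  by move=> E; move: suw; rewrite -(sb j) -E (aS i).1 eqxx.
have uNw : u <> w by move=> E; rewrite E eqxx in suw.
have aNu i : a i <> u by move=> E; move: suw; rewrite -E (aS i).1 eqxx.
have aNw i : a i <> w by apply/eqP; have [] := aS i.
have bNu i : b i <> u by apply/eqP; have [] := bP i.
have bNw i : b i <> w by move=> E; move: suw; rewrite -(sb i) E eqxx.
move=> [[]|[i c]] [[]|[j d]]; try elim/ord2P: c; try elim/ord2P: d; move=> //= E;
  try (by rewrite (ainj _ _ E)); try (by rewrite (binj _ _ E)); exfalso.
(* With both orientations of the equality at hand, each disequality above is needed in one direction
   only. *)
all: move: E (esym E).
all: by [move=> /uNw | move=> /aNu | move=> /aNw | move=> /bNu | move=> /bNw
  | move=> /sab | move=> _ /uNw | move=> _ /aNu | move=> _ /aNw | move=> _ /bNu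
  | move=> _ /bNw | move=> _ /sab].
Qed.

(** * Graphs satisfying the walk identity *)

Lemma common_weight (G : sgraph) (side : G -> bool) (M : nat) (x y : G) :
  walk_identity side -> volume G = (2 * M)%:R -> side x = side y -> x != y ->
  \sum_(z | adj x z && adj z y) (degree z)%:R^-1
    = 3 * (degree x)%:R * (degree y)%:R / (4 * M%:R) :> rat.
Proof.
move=> [_ W] vM sxy xy; rewrite -/(two_step x y) W // (negPf xy) mul0r add0r vM natrM.
(* For [M = 0] both sides vanish, since the inverse of 0 is 0. *)
have [->|M0] := eqVneq (M%:R : rat) 0; first by rewrite !mulr0 invr0 !mulr0 !mul0r.
by field.
Qed.

Lemma nbr_weight (G : sgraph) (side : G -> bool) (M : nat) (x : G) :
  walk_identity side -> volume G = (2 * M)%:R ->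
  \sum_(z | adj x z) (degree z)%:R^-1
    = (degree x)%:R / 4 + 3 * (degree x)%:R ^+ 2 / (4 * M%:R) :> rat.
Proof.
move=> [_ W] vM; transitivity (two_step x x).
  by apply: eq_bigl => z; rewrite [adj z x]adj_sym andbb.
rewrite W // eqxx !mul1r vM natrM.
have [->|M0] := eqVneq (M%:R : rat) 0; first by rewrite !mulr0 invr0 !mulr0 !mul0r.
by field.
Qed.

Lemma sum_nbr_weight (G : sgraph) (side : G -> bool) (b : bool) (F : G -> rat) :
  (forall x y : G, adj x y -> side y = ~~ side x) ->
  \sum_(x | side x == b) \sum_(z | adj x z) F z
    = \sum_(z | side z == ~~ b) (degree z)%:R * F z.
Proof.
move=> bip; rewrite (exchange_big_dep (fun z => side z == ~~ b)) /=; last first.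
  by move=> x z /eqP <- /bip ->.
apply: eq_bigr => z /eqP sz; rewrite degree_sum mulr_suml.
apply: eq_big => [x|x _]; last by rewrite mul1r.
rewrite [adj x z]adj_sym andbC; case: (boolP (adj z x)) => //= /bip ->.
by rewrite sz negbK eqxx.
Qed.

(** The sum of [1 / (degree x * degree z)] over all edges is the same seen from either side. The
    diagonal of the walk identity evaluates it as a quarter of the number of vertices of the side,
    plus [3 / 4]. *)
Lemma card_side (G : sgraph) (side : G -> bool) (b : bool) :
  (forall z : G, 0 < degree z)%N -> walk_identity side ->
  (2 * #|[set x | side x == b]| = #|G|)%N.
Proof.
move=> dpos [bip W].
have dn0 (z : G) : (degree z)%:R != 0 :> rat by rewrite pnatr_eq0 -lt0n.
pose S c : rat := \sum_(x | side x == c) two_step x x / (degree x)%:R.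
have SE c : S c = (#|[set x | side x == c]|)%:R / 4 + 3 / (2 * volume G) * (volume G / 2).
  rewrite -(side_volume c bip) -sum1dep_card natr_sum mulr_suml mulr_sumr -big_split.
  apply: eq_bigr => x _; rewrite W // eqxx mul1r /=; move: (3 / _) (dn0 x) => k ?.
  by rewrite mul1r; field.
have SS : S true = S false.
  have S2 c : S c = \sum_(x | side x == c) \sum_(z | side z == ~~ c)
      (adj x z)%:R / ((degree x)%:R * (degree z)%:R).
    apply: eq_bigr => x /eqP sx; rewrite mulr_suml [LHS]big_mkcond [RHS]big_mkcond /=.
    apply: eq_bigr => z _; rewrite [adj z x]adj_sym andbb.
    case: (boolP (adj x z)) => [/bip ->|_]; last by rewrite mul0r; case: ifP.
    by rewrite sx eqxx mul1r invfM mulrC.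
  rewrite !S2 /= exchange_big; apply: eq_bigr => x _; apply: eq_bigr => y _.
  by rewrite adj_sym mulrC [_ * (degree y)%:R]mulrC mulrC.
have EQ : #|[set x | side x == true]| = #|[set x | side x == false]|.
  apply/eqP; rewrite -(eqr_nat rat); apply/eqP.
  by move: SS; rewrite !SE; lra.
have : (#|[set x | side x == true]| + #|[set x | side x == false]| = #|G|)%N.
  rewrite -(cardsC [set x | side x == true]); congr (_ + _)%N.
  by apply: eq_card => x; rewrite !inE; case: (side x).
by case: b; rewrite EQ; lia.
Qed.

(** Here [M] is the number of edges and [n] the size of a side. Summing the diagonal identity over
    one side gives [n] on the left; on the right, the sum of squared degrees is at least [k] times
    the sum of degrees, which is [M]. *)
Lemma second_moment (G : sgraph) (side : G -> bool) (M n k : nat) :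
  (forall z : G, 0 < degree z)%N -> walk_identity side -> volume G = (2 * M)%:R ->
  (0 < M)%N -> #|G| = (2 * n)%N -> (forall z : G, k <= degree z)%N ->
  (k * n <= M)%N /\ (M + 3 * k <= 4 * n)%N.
Proof.
move=> dpos W vM M0 cardG kle; have [bip _] := W.
have card b : #|[set x | side x == b]| = n by have := card_side b dpos W; lia.
have sumd : \sum_(x | side x == true) (degree x)%:R = M%:R :> rat.
  by rewrite (side_volume true bip) vM natrM; field.
have Mn0 : (0 : rat) < M%:R by rewrite ltr0n.
split.
  rewrite -(ler_nat rat) -sumd natrM -(card true) -sum1dep_card natr_sum mulr_sumr.
  by apply: ler_sum => x _; rewrite mulr1 ler_nat.
have E : \sum_(x | side x == true) \sum_(z | adj x z) (degree z)%:R^-1 = n%:R :> rat.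
  rewrite (sum_nbr_weight _ _ bip) -(card false) -sum1dep_card natr_sum.
  by apply: eq_bigr => z _; rewrite divff // pnatr_eq0 -lt0n.
have : M%:R / 4 + 3 * k%:R / 4 <= n%:R :> rat.
  rewrite -E; apply: (@le_trans _ _ (\sum_(x | side x == true)
     ((degree x)%:R / 4 + 3 * k%:R / (4 * M%:R) * (degree x)%:R))).
    rewrite big_split -mulr_suml -mulr_sumr sumd /=.
    by rewrite lerD2l le_eqVlt; apply/orP; left; apply/eqP; field; rewrite gt_eqF.
  apply: ler_sum => x _; rewrite (nbr_weight _ W vM) lerD2l mulrAC ler_pM2r; last first.
    by rewrite invr_gt0 mulr_gt0.
  by rewrite expr2 -mulrA ler_pM2l // ler_wpM2r ?ler_nat.
move=> H; rewrite -(ler_nat rat) natrD !natrM; lra.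
Qed.

Lemma common_neighbor (G : sgraph) (side : G -> bool) (M : nat) (x y : G) :
  (forall z : G, 0 < degree z)%N -> walk_identity side -> volume G = (2 * M)%:R ->
  (0 < M)%N -> side x = side y -> x != y -> exists z, adj x z && adj y z.
Proof.
move=> dpos W vM M0 sxy xy; apply/existsP; apply: contraT => /existsPn H.
have := common_weight W vM sxy xy; rewrite big_pred0 => [/esym/eqP|z]; last first.
  by rewrite [adj z y]adj_sym; apply/negbTE/H.
by rewrite gt_eqF // !(divr_gt0, mulr_gt0) ?ltr0n.
Qed.

(** Double counting of two-step walks from [x]: those returning to [x] number [degree x], and each
    of the [n] other vertices on its side is reached at least once, by [common_neighbor]. *)
Lemma nbr_degree_sum (G : sgraph) (side : G -> bool) (M n : nat) (x : G) :
  (forall z : G, 0 < degree z)%N -> walk_identity side -> volume G = (2 * M)%:R ->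
  (0 < M)%N -> #|G| = (2 * n.+1)%N ->
  (degree x + n <= \sum_(z | adj x z) degree z)%N.
Proof.
move=> dpos W vM M0 cardG; have [bip _] := W.
have cardA : #|[set y | side y == side x] :\ x| = n.
  have := card_side (side x) dpos W; rewrite cardG.
  by rewrite (cardsD1 x [set y | _]) inE eqxx; lia.
have -> : (\sum_(z | adj x z) degree z = \sum_y \sum_(z | adj x z && adj y z) 1)%N.
  rewrite (eq_bigr (fun z => \sum_(y | adj y z) 1)%N); last first.
    move=> z _; rewrite sum1dep_card; apply: eq_card => y; rewrite !inE.
    exact: adj_sym.
  rewrite (exchange_big_dep predT) //=.
rewrite (bigD1 x) //=; apply: leq_add.
  by rewrite /degree sum1dep_card; apply/subset_leq_card/subsetP => z; rewrite !inE andbb.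
rewrite -{1}cardA -sum1_card big_mkcond [leqRHS]big_mkcond; apply: leq_sum => y _.
rewrite !inE; case: eqP => //= /eqP yx; case: eqP => // /esym syx.
have [|z xyz] := common_neighbor dpos W vM M0 syx; first by rewrite eq_sym.
by rewrite (bigD1 z).
Qed.

(** * Degrees of the neighbours of a vertex of minimum degree *)

Lemma big_nbr (R : Type) (idx : R) (op : Monoid.com_law idx) (G : sgraph) (x : G)
    (F : G -> R) :
  \big[op/idx]_(z | adj x z) F z
    = \big[op/idx]_(z <- enum [set z | adj x z]) F z.
Proof. by rewrite big_enum; apply: eq_bigl => z; rewrite inE. Qed.

Lemma mem_nbr (G : sgraph) (x z : G) : (z \in enum [set z | adj x z]) = adj x z.
Proof. by rewrite mem_enum inE. Qed.

Lemma invn_le (k a : nat) : (0 < k)%N -> (k <= a)%N -> a%:R^-1 <= k%:R^-1 :> rat.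
Proof.
move=> k0 ka; rewrite lef_pV2 ?ler_nat // posrE ltr0n //; exact: leq_trans k0 ka.
Qed.

(** The reciprocals sum to more than [3 / 4], which forces [a = 3] and then [b] equal to 3 or 4; the
    bounds on [M] exclude both. *)
Lemma three_nbr_degrees_sorted (a b c M t : nat) :
  (2 < a)%N -> (a <= b)%N -> (b <= c)%N -> (0 < M)%N ->
  a%:R^-1 + b%:R^-1 + c%:R^-1 = 3 / 4 + 27 / (4 * M%:R) :> rat ->
  (3 + t <= a + b + c)%N -> (M + 9 <= 4 * t.+1)%N -> False.
Proof.
move=> a3 ab bc M0 E H1 H2.
have Mpos : 0 < 27 / (4 * M%:R) :> rat by rewrite divr_gt0 ?mulr_gt0 ?ltr0n.
have EN : (4 * M * (a * b + b * c + c * a) = 3 * (M + 9) * (a * b * c))%N.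
  apply/eqP; rewrite -(eqr_nat rat) !(natrM, natrD).
  have [? ? ? ?] : [/\ a%:R != 0 :> rat, b%:R != 0 :> rat, c%:R != 0 :> rat & M%:R != 0 :> rat].
    by rewrite !pnatr_eq0; split; lia.
  apply/eqP; transitivity (4 * M%:R * (a%:R * b%:R * c%:R) * (a%:R^-1 + b%:R^-1 + c%:R^-1) : rat).
    by field; apply/and3P.
  by rewrite E; field.
have a_eq : a = 3%N.
  apply/eqP; rewrite eqn_leq a3 andbT leqNgt; apply/negP => a4.
  have ca : (a <= c)%N := leq_trans ab bc.
  have := @invn_le 4 a isT a4; have := @invn_le 4 b isT (leq_trans a4 ab).
  by have := @invn_le 4 c isT (leq_trans a4 ca); lra.
subst a; have b4 : (b < 5)%N.
  rewrite ltnNge; apply/negP => b5; have := @invn_le 5 b isT b5.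
  by have := @invn_le 5 c isT (leq_trans b5 bc); lra.
(* Inserted in the cleared equation, this gives [9 c <= M] for either value of [b], while the last
   two hypotheses give [M <= 4 c + 11]; since [3 <= c] this is impossible. *)
have cM : (3 * M <= c * M)%N by rewrite leq_mul2r (leq_trans ab bc) orbT.
clear E Mpos; have [b3|b4'] := leqP b 3.
  have bE : b = 3%N by lia.
  by subst b; nia.
have bE : b = 4%N by lia.
by subst b; nia.
Qed.

Lemma three_nbr_degrees (a b c M t : nat) :
  (2 < a)%N -> (2 < b)%N -> (2 < c)%N -> (0 < M)%N ->
  a%:R^-1 + b%:R^-1 + c%:R^-1 = 3 / 4 + 27 / (4 * M%:R) :> rat ->
  (3 + t <= a + b + c)%N -> (M + 9 <= 4 * t.+1)%N -> False.
Proof.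
wlog ab : a b / (a <= b)%N => [H a3 b3 c3 M0 E H1 H2|].
  case: (leqP a b) => [|/ltnW] ab; first exact: (H a b).
  by apply: (H b a) => //; [lra | lia].
wlog bc : a b c ab / (b <= c)%N => [H a3 b3 c3 M0 E H1 H2|a3 _ _].
  case: (leqP b c) => [|/ltnW] bc; first exact: (H a b c).
  case: (leqP a c) => [|/ltnW] ac.
    by apply: (H a c b) => //; [lra | lia].
  by apply: (H c a b) => //; [lra | lia].
exact: three_nbr_degrees_sorted.
Qed.

(** Take [a <= b]. If [a = 2], the equation reads [1 / b = 3 / M]. If [a] is at least 4, the
    reciprocals sum to at most [1 / 2]. The value [a = 3] is excluded by the bound on [M]. *)
Lemma two_nbr_degrees (a b M t : nat) :
  (1 < a)%N -> (1 < b)%N -> (0 < M)%N ->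
  a%:R^-1 + b%:R^-1 = 1 / 2 + 3 / M%:R :> rat ->
  (a + b = t + 2)%N -> (M + 6 <= 4 * t.+1)%N ->
  M = (3 * t)%N /\ (a = 2 /\ b = t \/ a = t /\ b = 2)%N.
Proof.
wlog ab : a b / (a <= b)%N => [H a2 b2 M0 E H1 H2|a2 b2 M0 E H1 H2].
  case: (leqP a b) => [|/ltnW] ab; first exact: (H a b).
  have [| |MT] := H b a ab b2 a2 M0 _ _ H2; [by rewrite addrC|by rewrite addnC|].
  by split=> //; tauto.
have EN : (2 * M * (a + b) = (M + 6) * (a * b))%N.
  have [? ? ?] : [/\ a%:R != 0 :> rat, b%:R != 0 :> rat & M%:R != 0 :> rat].
    by rewrite !pnatr_eq0; split; lia.
  apply/eqP; rewrite -(eqr_nat rat) !(natrM, natrD).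
  apply/eqP; transitivity (2 * M%:R * (a%:R * b%:R) * (a%:R^-1 + b%:R^-1) : rat).
    by field; apply/andP.
  by rewrite E; field.
clear E; have [a2'|a3] := leqP a 2.
  have aE : a = 2%N by lia.
  by subst a; split; [nia|left; split; lia].
exfalso; have aE : a = 3%N.
  apply/eqP; rewrite eqn_leq a3 andbT leqNgt; apply/negP => a4.
  have : (4 * ((M + 6) * b) <= a * ((M + 6) * b))%N by rewrite leq_mul2r a4 orbT.
  have : (M * a <= M * b)%N by rewrite leq_mul2l ab orbT.
  by nia.
(* The equation now yields [6 b <= M], whereas [b = t - 1] and the bound on [M] yield
   [M <= 4 b + 2]. *)
subst a; have : (M * 3 <= M * b)%N by rewrite leq_mul2l ab orbT.
by nia.
Qed.

Lemma min_degree_le2 (G : sgraph) (side : G -> bool) (t M : nat) (x : G) :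
  (forall z : G, 0 < degree z)%N -> walk_identity side -> volume G = (2 * M)%:R ->
  (0 < M)%N -> #|G| = (2 * t.+1)%N -> (forall z : G, degree x <= degree z)%N ->
  (degree x <= 2)%N.
Proof.
move=> dpos W vM M0 cardG xmin; have [M1 M2] := second_moment dpos W vM M0 cardG xmin.
(* With [k] the minimum degree, [k (t + 1) <= M <= 4 (t + 1) - 3 k]. *)
have deg4 : (degree x < 4)%N by nia.
rewrite leqNgt; apply/negP => deg3.
have dx3 : degree x = 3%N by lia.
have := nbr_weight x W vM; have := nbr_degree_sum x dpos W vM M0 cardG.
have := mem_nbr x; rewrite !big_nbr.
have : size (enum [set z | adj x z]) = 3%N by rewrite -cardE.
case: (enum _) => [|a [|b [|c [|]]]] // _ mem_s.
rewrite !big_cons !big_nil /= addr0 addn0 dx3 !addrA !addnA => S1 S2.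
apply: (@three_nbr_degrees (degree a) (degree b) (degree c) M t) => //.
- by rewrite -dx3.
- by rewrite -dx3.
- by rewrite -dx3.
by move: M2; rewrite dx3.
Qed.

(** * Reconstruction of the theta graph in minimum degree 1 and 2 *)

(** The neighbour [z] of the leaf is the only possible common neighbour, so it is adjacent to the
    whole side of [x] and has degree [t + 1]. The identity then forces [t = 1] and [M = 3]: the
    graph is the path [x], [z], [y], [u], whose ends are the hubs. *)
Lemma theta_of_leaf (G : sgraph) (side : G -> bool) (t M : nat) (x : G) :
  (0 < t)%N -> (forall z : G, 0 < degree z)%N -> walk_identity side ->
  volume G = (2 * M)%:R -> (0 < M)%N -> #|G| = (2 * t.+1)%N -> degree x = 1%N ->
  isomorphic G (theta t 2).
Proof.
move=> t0 dpos W vM M0 cardG dx1; have [bip _] := W.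
have card b : #|[set y | side y == b]| = t.+1 by have := card_side b dpos W; lia.
have Mn0 : M%:R != 0 :> rat by rewrite pnatr_eq0 -lt0n.
have := nbr_weight x W vM; have := mem_nbr x; rewrite big_nbr.
have : size (enum [set z | adj x z]) = 1%N by rewrite -cardE.
case: (enum _) => [|z []] // _ Nx; rewrite big_seq1 dx1 => wz.
have {}Nx v : adj x v = (v == z) by rewrite -Nx inE.
have sz : side z = ~~ side x by apply: bip; rewrite Nx.
have zall y : side y = side x -> adj z y.
  move=> syx; have [->|yx] := eqVneq y x; first by rewrite adj_sym Nx.
  have [|v] := common_neighbor dpos W vM M0 (esym syx); first by rewrite eq_sym.
  by rewrite Nx => /andP[/eqP -> ]; rewrite adj_sym.
have dz : degree z = t.+1.
  rewrite -(card (side x)); apply: eq_card => y; rewrite !inE.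
  apply/idP/eqP => [/bip ->|/zall //]; by rewrite sz negbK.
have dy y : side y = side x -> y != x -> (3 * degree y = M + 3)%N.
  move=> syx yx; have := common_weight W vM (esym syx); rewrite eq_sym => /(_ yx).
  rewrite (big_pred1 z); last by move=> v; rewrite Nx /=; case: eqP => //= ->; rewrite zall.
  rewrite wz dx1 => E; apply/eqP; rewrite -(eqr_nat rat) natrM natrD; apply/eqP.
  transitivity (4 * M%:R * (3 * 1 * (degree y)%:R / (4 * M%:R)) : rat); first by field.
  by rewrite -E; field.
have [y] : exists2 y, y \in [set y | side y == side x] & y != x.
  by apply: card_gt1_neq; rewrite card.
rewrite inE => /eqP sy yx.
have dyt : (degree y <= t.+1)%N.
  rewrite -(card (~~ side x)) /degree; apply/subset_leq_card/subsetP => v; rewrite !inE.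
  by move/bip ->; rewrite sy.
have Mt : (4 * M = (M + 3) * t.+1)%N.
  apply/eqP; rewrite -(eqr_nat rat) !(natrM, natrD); apply/eqP.
  transitivity (4 * M%:R * t.+1%:R * t.+1%:R^-1 : rat); first by rewrite mulfK ?pnatr_eq0.
  by rewrite -dz wz dz; field.
(* From [4 M = (M + 3) (t + 1)] and [M + 3 = 3 degree y <= 3 (t + 1)]. *)
have {}t0 : t = 1%N by have := dy y sy yx; nia.
have M3 : M = 3%N by subst t; lia.
have dy2 : degree y = 2%N by have := dy y sy yx; lia.
subst t M; clear Mt dyt dy wz.
have [u] : exists2 u, u \in [set u | side u == side z] & u != z.
  by apply: card_gt1_neq; rewrite card.
rewrite inE => /eqP su uz.
have two b p q r : side p = b -> side q = b -> side r = b ->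
    p != q -> r != q -> r = p.
  move=> sp sq sr pq rq; apply/eqP; apply: contraT => rp.
  have := card b; rewrite (cardsD1 p) (cardsD1 q) (cardsD1 r) !inE sp sq sr eqxx.
  by rewrite eq_sym pq rq rp.
have yu : adj y u.
  apply: contraT => yu; have : (degree y <= 1)%N.
    rewrite -(cards1 z) /degree; apply/subset_leq_card/subsetP => v; rewrite !inE => yv.
    apply/eqP/(two (side z) _ u) => //; first by rewrite (bip _ _ yv) sy sz.
      by rewrite eq_sym.
    by apply: contraNN yu => /eqP <-.
  by rewrite dy2.
have yuniq v : side v = side x -> v != x -> v = y.
  by move=> sv vx; apply: (two (side x) _ x).
apply: (@theta_of_hubs G side 1 x u).
- by rewrite cardG.
- exact: card.
- exact: bip.
- by rewrite su sz.
- by rewrite Nx.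
- by move=> v sv vx; rewrite (yuniq v) // adj_sym.
- move=> v sv vu; rewrite Nx; apply/eqP/(two (side z) _ u) => //.
    by rewrite sv.
  by rewrite eq_sym.
- move=> v sv vx; rewrite (yuniq v) //; exists z; split; first by rewrite eq_sym.
    by rewrite adj_sym zall.
  move=> v' yv'; rewrite !inE; have [//|v'u] := eqVneq v' u.
  apply/eqP/(two (side z) _ u) => //; first by rewrite (bip _ _ yv') sy sz.
  by rewrite eq_sym.
move=> v v' q sv sv' vx v'x; rewrite (yuniq v) // (yuniq v') //.
by rewrite eqxx.
Qed.

(** The path [u], [x], [z], [w] runs between the future hubs, [w] being the second neighbour of [z].
    Comparison with [x] in the walk identity gives all degrees on this side. *)
Lemma theta_of_degree2_path (G : sgraph) (side : G -> bool) (t : nat) (x z u : G) :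
  (0 < t)%N -> (forall v : G, 0 < degree v)%N -> walk_identity side ->
  volume G = (2 * (3 * t))%:R -> #|G| = (2 * t.+1)%N -> z != u ->
  (forall v, adj x v = (v \in [:: z; u])) ->
  (forall y, side y = side x -> y != x -> ~~ (adj y z && adj y u)) ->
  degree z = 2%N -> degree u = t -> isomorphic G (theta t 2).
Proof.
move=> t0 dpos W vM cardG zu Nx notboth dz du; have [bip _] := W.
have M0 : (0 < 3 * t)%N by rewrite muln_gt0.
have tn0 : t%:R != 0 :> rat by rewrite pnatr_eq0 -lt0n.
have card b : #|[set y | side y == b]| = t.+1 by have := card_side b dpos W; lia.
have xz : adj x z by rewrite Nx inE eqxx.
have xu : adj x u by rewrite Nx !inE eqxx orbT.
have dx : degree x = 2%N.
  transitivity #|[set z; u]|; last by rewrite cards2 zu.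
  by apply: eq_card => v; rewrite !inE Nx !inE.
have [w] : exists2 w, w \in [set w | adj z w] & w != x.
  by apply: card_gt1_neq; rewrite -/(degree z) dz.
rewrite inE => zw wx.
have sw : side w = side x by rewrite (bip _ _ zw) (bip _ _ xz) negbK.
have wu : ~~ adj w u.
  by have := notboth w sw wx; rewrite adj_sym zw.
have Nz v : adj z v -> v \in [:: x; w].
  move=> zv; apply: contraT => vxw.
  have : (2 < degree z)%N.
    rewrite /degree (cardsD1 x) (cardsD1 w) (cardsD1 v) !inE zw zv adj_sym xz wx.
    by move: vxw; rewrite !inE negb_or => /andP[-> ->].
  by rewrite dz.
have yu y : side y = side w -> y != w -> adj u y.
  rewrite sw => sy yw; have [->|yx] := eqVneq y x; first by rewrite adj_sym.
  have [|v] := common_neighbor dpos W vM M0 (esym sy); first by rewrite eq_sym.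
  rewrite Nx !inE => /andP[/orP[]/eqP->]; rewrite adj_sym // => /Nz.
  by rewrite !inE (negPf yx) (negPf yw).
have weight y y' : side y = side y' -> y != y' ->
    \sum_(v | adj y v && adj v y') (degree v)%:R^-1
    = (degree y)%:R * (degree y')%:R / (4 * t%:R) :> rat.
  by move=> sy yy'; rewrite (common_weight W vM sy yy') natrM; field.
(* The only common neighbour of [x] and [y] is [u], so [1 / t = 2 degree y / (4 t)]. *)
have dy y : side y = side w -> y != w -> degree y = 2%N.
  move=> sy yw; have [->//|yx] := eqVneq y x; rewrite sw in sy.
  have := weight x y (esym sy); rewrite eq_sym => /(_ yx).
  rewrite (big_pred1 u) => [|v]; last first.
    rewrite Nx !inE /=; have [->|_] := eqVneq v u; first by rewrite orbT yu // sw.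
    rewrite orbF; case: eqP => //= ->; apply/negP => /Nz.
    by rewrite !inE (negPf yx) (negPf yw).
  rewrite dx du => E; apply/eqP; rewrite -(eqr_nat rat); apply/eqP.
  transitivity (2 * t%:R * (2 * (degree y)%:R / (4 * t%:R)) : rat); first by field.
  by rewrite -E; field.
(* The only common neighbour of [x] and [w] is [z], so [1 / 2 = 2 degree w / (4 t)]. *)
have dw : degree w = t.
  have := weight x w (esym sw); rewrite eq_sym => /(_ wx).
  rewrite (big_pred1 z) => [|v]; last first.
    rewrite Nx !inE /=; have [->|_] /= := eqVneq v z; first by [].
    by case: eqP => //= ->; apply/negbTE; rewrite adj_sym.
  rewrite dx dz => E; apply/eqP; rewrite -(eqr_nat rat); apply/eqP.
  transitivity (2 * t%:R * (2 * (degree w)%:R / (4 * t%:R)) : rat); first by field.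
  by rewrite -E; field.
have su : side u = ~~ side w by rewrite sw; exact: bip.
apply: (@theta_of_hubs G side t w u) => //.
- by rewrite cardG mulnS mulnC.
(* The neighbours of [w] lie among the [t] vertices other than [u] on the opposite side. Missing one
   more would contradict [degree w = t]. *)
- move=> v sv vu; apply: contraT => wv.
  have sub : [set y | adj w y] \subset [set y | side y == side u] :\ u :\ v.
    apply/subsetP => y; rewrite !inE => wy; rewrite su (bip _ _ wy) eqxx andbT.
    by apply/andP; split; apply: contraTneq wy => ->.
  have := subset_leq_card sub; rewrite -/(degree w) dw.
  have := card (side u); rewrite (cardsD1 u) (cardsD1 v) !inE sv vu !eqxx !add1n.
  by case=> <-; rewrite ltnn.
- move=> y sy yw; have uy := yu y sy yw.
  have [v] : exists2 v, v \in [set v | adj y v] & v != u.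
    by apply: card_gt1_neq; rewrite -/(degree y) dy.
  rewrite inE => yv vu; exists v; split=> // v' yv'; apply: contraT => v'uv.
  have : (2 < degree y)%N.
    rewrite /degree (cardsD1 u) (cardsD1 v) (cardsD1 v') !inE adj_sym uy yv yv' vu.
    by move: v'uv; rewrite !inE negb_or => /andP[-> ->].
  by rewrite dy.
move=> y y' v sy sy' yw y'w yy' yv y'v; apply/eqP; apply: contraT => vu.
(* The common weight of [y] and [y'] is [1 / t], already exhausted by [u]. *)
have := weight y y' (etrans sy (esym sy')) yy'.
rewrite !dy // (bigD1 u) /=; last by rewrite yu // adj_sym yu.
rewrite (bigD1 v) /=; last by rewrite yv adj_sym y'v vu.
have v0 : 0 < (degree v)%:R^-1 :> rat by rewrite invr_gt0 ltr0n.
rewrite du; have -> : 2 * 2 / (4 * t%:R) = t%:R^-1 :> rat by field.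
move/eqP; rewrite -subr_eq0 addrAC subrr add0r gt_eqF //.
by apply: ltr_wpDr => //; apply: sumr_ge0 => *; rewrite invr_ge0 ler0n.
Qed.

(** The neighbours [a] and [b] of [x] share only [x], and each other vertex of its side is adjacent
    to one of them. This fixes the sum of their degrees, the diagonal identity at [x] fixes the sum
    of the reciprocals, and so the degrees are 2 and [t]. *)
Lemma theta_of_min_degree2 (G : sgraph) (side : G -> bool) (t M : nat) (x : G) :
  (0 < t)%N -> (forall z : G, 0 < degree z)%N -> walk_identity side ->
  volume G = (2 * M)%:R -> (0 < M)%N -> #|G| = (2 * t.+1)%N ->
  (forall z : G, 2 <= degree z)%N -> degree x = 2%N ->
  isomorphic G (theta t 2).
Proof.
move=> t0 dpos W vM M0 cardG dge2 dx2; have [bip _] := W.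
have Mn0 : M%:R != 0 :> rat by rewrite pnatr_eq0 -lt0n.
have [_ M2] := second_moment dpos W vM M0 cardG dge2.
have := nbr_weight x W vM; have := mem_nbr x; rewrite big_nbr.
have : size (enum [set z | adj x z]) = 2%N by rewrite -cardE.
have := enum_uniq [set z | adj x z].
case: (enum _) => [|a [|b []]] //=; rewrite inE andbT => ab _ Nx.
rewrite !big_cons big_nil /= addr0 dx2 => S2.
have {}Nx v : adj x v = (v \in [:: a; b]) by rewrite Nx.
(* A vertex adjacent to both neighbours of [x] would have degree [M / 3 + 2],
   while [nbr_weight] and minimum degree 2 bound every degree by [M / 3]. *)
have notboth y : side y = side x -> y != x -> ~~ (adj y a && adj y b).
  move=> sy yx; apply/negP => /andP[ya yb].
  have := common_weight W vM (esym sy); rewrite eq_sym => /(_ yx).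
  have -> : \sum_(v | adj x v && adj v y) (degree v)%:R^-1 = \sum_(v | adj x v) (degree v)%:R^-1 :> rat.
    apply: eq_bigl => v; rewrite Nx !inE; case: eqP => [->|_] /=; first by rewrite adj_sym ya.
    by case: eqP => [->|//]; rewrite adj_sym yb.
  rewrite (nbr_weight x W vM) dx2 => E.
  have dyE : 3 * (degree y)%:R = M%:R + 6 :> rat.
    transitivity (2 * M%:R * (3 * 2 * (degree y)%:R / (4 * M%:R)) : rat); first by field.
    by rewrite -E; field.
  have : \sum_(v | adj y v) (degree v)%:R^-1 <= (degree y)%:R / 2 :> rat.
    rewrite degree_sum mulr_suml; apply: ler_sum => v _; rewrite mul1r.
    exact: (@invn_le 2).
  rewrite (nbr_weight y W vM) => H.
  have dy0 : 0 < (degree y)%:R :> rat by rewrite ltr0n.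
  have Mp : 0 < M%:R :> rat by rewrite ltr0n.
  have : 3 * (degree y)%:R <= M%:R :> rat.
    rewrite -(ler_pM2r (divr_gt0 dy0 (mulr_gt0 (ltr0n _ 4) Mp))).
    have -> : 3 * (degree y)%:R * ((degree y)%:R / (4 * M%:R))
        = 3 * (degree y)%:R ^+ 2 / (4 * M%:R) :> rat by field.
    have -> : M%:R * ((degree y)%:R / (4 * M%:R)) = (degree y)%:R / 4 :> rat by field.
    lra.
  by rewrite dyE; lra.
have cardA : #|[set y | side y == side x] :\ x| = t.
  have := card_side (side x) dpos W; rewrite cardG.
  by rewrite (cardsD1 x [set y | _]) inE eqxx; lia.
have dab : (degree a + degree b = t + 2)%N.
  have xa : adj x a by rewrite Nx inE eqxx.
  have xb : adj x b by rewrite Nx !inE eqxx orbT.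
  have le1 := nbr_degree_sum x dpos W vM M0 cardG.
  have le2 : (#|[set y | adj a y] :\ x| + #|[set y | adj b y] :\ x| <= t)%N.
    rewrite -cardsUI -cardA [X in (_ + X)%N](_ : _ = 0)%N ?addn0; last first.
      apply/eqP; rewrite cards_eq0; apply/eqP/setP => y; rewrite !inE.
      apply/negP => /andP[/andP[yx ay] /andP[_ yb]].
      have := notboth y; rewrite (bip _ _ ay) (bip _ _ xa) negbK => /(_ erefl yx).
      by rewrite adj_sym ay adj_sym yb.
    apply/subset_leq_card/subsetP => y; rewrite !inE -andb_orr => /andP[-> /=].
    by case/orP => /bip ->; rewrite ?(bip _ _ xa) ?(bip _ _ xb) negbK.
  have : (\sum_(z | adj x z) degree z = degree a + degree b)%N.
    rewrite (eq_bigl (mem [:: a; b])); last by move=> v; rewrite Nx.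
    by rewrite -big_uniq /= ?inE ?ab // !big_cons big_nil addn0.
  move: le1 le2; rewrite dx2 /degree (cardsD1 x [set y | adj a y]) (cardsD1 x [set y | adj b y]).
  rewrite !inE [adj a x]adj_sym [adj b x]adj_sym xa xb; lia.
have [||MT] := @two_nbr_degrees (degree a) (degree b) M t (dge2 a) (dge2 b) M0 _ dab _.
- by rewrite S2; field.
- by move: M2; lia.
rewrite MT in vM; case=> -[da db].
  exact: (theta_of_degree2_path t0 dpos W vM cardG ab Nx notboth da db).
apply: (@theta_of_degree2_path G side t x b a) => //.
- by rewrite eq_sym.
- by move=> v; rewrite Nx !inE orbC.
- by move=> y sy yx; rewrite andbC notboth.
Qed.

Lemma theta_of_walk_identity (G : sgraph) (side : G -> bool) (t : nat) :
  (0 < t)%N -> (forall z : G, 0 < degree z)%N -> #|G| = (2 * t + 2)%N ->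
  walk_identity side -> isomorphic G (theta t 2).
Proof.
move=> t0 dpos cardG W; have [bip _] := W.
have [x0 _] : exists x : G, true.
  by move: cardG; case: (pickP G) => [x _|/eq_card0 ->]; [exists x|lia].
(* The number of edges, obtained as the degree sum of one side. *)
have [M vM] : exists M : nat, volume G = (2 * M)%:R.
  exists (\sum_(x | side x == true) degree x)%N.
  by rewrite natrM natr_sum (side_volume true bip); field.
have M0 : (0 < M)%N.
  by have := volume_gt0 (dpos x0); rewrite vM ltr0n; lia.
have {}cardG : #|G| = (2 * t.+1)%N by lia.
case: (@arg_minnP _ x0 predT (@degree G) isT) => x _ xmin.
have {}xmin (z : G) : (degree x <= degree z)%N by exact: xmin.
have := min_degree_le2 dpos W vM M0 cardG xmin; rewrite leq_eqVlt => /orP[/eqP dx|dx].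
  by apply: (theta_of_min_degree2 t0 dpos W vM M0 cardG _ dx) => z; rewrite -dx.
by apply: (theta_of_leaf t0 dpos W vM M0 cardG (x := x)); have := dpos x; lia.
Qed.

Theorem theorem1p3 (C : numClosedFieldType) (G : sgraph) (t : nat)
  (hG : connected G) (ht : (1 <= t)%N) :
  isomorphic G (theta t 2) <->
  Spec (normalized_adjacency_mx C G) =
    (msetn 1%N (1 : C) `+` msetn t (1 / 2 : C)
       `+` msetn t (- (1 / 2) : C) `+` msetn 1%N (- 1 : C))%mset.
Proof.
(* A connected graph with at least two vertices has no isolated vertex, so the zero convention in
   [degree_mx_invsqrt] is never met. *)
have cardP : #|G| = (2 * t + 2)%N -> forall z : G, (0 < degree z)%N.
  by move=> cardG; apply: degree_gt0 => //; lia.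
split=> [iso|SpecT].
  have cardG : #|G| = (2 * t + 2)%N.
    have [f fbij _] := iso; rewrite (bij_eq_card fbij) card_theta; lia.
  have [side W] := walk_identity_iso iso (theta_walk_identity ht).
  exact: spectrum_of_walk (cardP cardG) cardG W.
have cardG := card_of_spectrum SpecT.
have [side W] := walk_of_spectrum hG (cardP cardG) SpecT.
exact: theta_of_walk_identity ht (cardP cardG) cardG W.
Qed.
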